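(* Let $D$ be an integral domain with quotient field $K$, let $X,Y$ be two indeterminates over $D$, and let $\star$ be a semistar operation on $D$. Set $D_1:=D[X]$, $K_1:=K(X)$ and $$\Theta_1^{\star}:=\{Q_1\in\operatorname{Spec}(D_1)\mid Q_1\cap D=(0)\text{ or }(Q_1\cap D)^{\star_f}\subsetneq D^{\star}\},$$ $$\mathfrak{S}_1^{\star}:=D_1[Y]\setminus\bigcup\{Q_1[Y]\mid Q_1\in\Theta_1^{\star}\},$$ $$E^{\star[X]}:=E[Y]_{\mathfrak{S}_1^{\star}}\cap K_1\quad\text{for all }E\in\overline{\mathcal F}(D_1).$$ Then: (a) The mapping $\star[X]:\overline{\mathcal F}(D_1)\to\overline{\mathcal F}(D_1)$, $E\mapsto E^{\star[X]}$, is a stable semistar operation of finite type on $D[X]$, i.e., $\widetilde{\star[X]}=\star[X]$. (b) $\widetilde{\star}[X]=\star_f[X]=\star[X]$. (c) $\star[X]\le[\star]$. In particular, if $\star$ is a (semi)star operation on $D$, then $\star[X]$ is a (semi)star operation on $D[X]$. (d) $d_D[X]=d_{D[X]}$.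
   Context: For a domain $D$ with quotient field $K$, $\overline{\mathcal F}(D)$ is the set of nonzero $D$-submodules of $K$ and $f(D)$ the set of nonzero finitely generated $D$-submodules of $K$. A semistar operation on $D$ is a map $\star:\overline{\mathcal F}(D)\to\overline{\mathcal F}(D)$, $E\mapsto E^\star$, such that for all $0\ne x\in K$ and $E,F\in\overline{\mathcal F}(D)$: $(xE)^\star=xE^\star$; $E\subseteq F$ implies $E^\star\subseteq F^\star$; $E\subseteq E^\star=(E^\star)^\star$. It is a (semi)star operation if $D^\star=D$. It is stable if $(E\cap F)^\star=E^\star\cap F^\star$ for all $E,F\in\overline{\mathcal F}(D)$ with $E\cap F\neq(0)$. Define $E^{\star_f}:=\bigcup\{F^\star\mid F\in f(D),F\subseteq E\}$; $\star$ is of finite type if $\star=\star_f$. A nonzero ideal $I$ of $D$ is a quasi-$\star$-ideal if $I^\star\cap D=I$; $\operatorname{QMax}^{\star}(D)$ is the set of maximal elements of the set of proper quasi-$\star$-ideals (they are prime). $\widetilde\star$ is the semistar operation $E^{\widetilde\star}:=\bigcap\{ED_P\mid P\in\operatorname{QMax}^{\star_f}(D)\}$ (equal to $K$ if $\operatorname{QMax}^{\star_f}(D)=\emptyset$). For semistar operations, $\star_1\le\star_2$ means $E^{\star_1}\subseteq E^{\star_2}$ for all $E$. $d_D$ is the identity operation on $\overline{\mathcal F}(D)$. For a multiplicative set $\mathcal S\subseteq D_1[Y]$ and $E\in\overline{\mathcal F}(D_1)$, $E[Y]_{\mathcal S}$ is the localization $\mathcal S^{-1}E[Y]\subseteq K_1(Y)$.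 The operation $[\star]$ on $D_1=D[X]$ (of Chang and Fontana) is defined by $E^{[\star]}:=E[Y]_{\mathcal S_1^\star}\cap K_1$, where $\mathcal S_1^\star:=D_1[Y]\setminus\bigcup\{Q_1[Y]\mid Q_1\in\Delta_1^\star\}$ and $\Delta_1^\star$ is the set of $Q_1\in\operatorname{Spec}(D_1)$ such that either $Q_1\cap D=(0)$, or both $Q_1=(Q_1\cap D)[X]$ and $(Q_1\cap D)^{\star_f}\subsetneq D^\star$; it is a semistar operation on $D[X]$. *)

(* Defs.v *)
From HB Require Import structures.
From mathcomp Require Import all_boot all_order all_algebra.
From mathcomp Require Import boolp classical_sets.

Set Implicit Arguments.
Unset Strict Implicit.
Unset Printing Implicit Defensive.

Import GRing.Theory.
Local Open Scope ring_scope.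
Local Open Scope classical_set_scope.

Section Ideals.
Variable R : comNzRingType.

Definition is_ideal (I : set R) : Prop :=
  [/\ I 0, forall x y, I x -> I y -> I (x + y)
    & forall a x, I x -> I (a * x)].

Definition Spec : set (set R) :=
  [set P | [/\ is_ideal P, P <> setT & prime_idealr_closed [in P]]].

End Ideals.

(* The quotient field of D is {fraction D}, and D is identified with its image
   under tofrac. *)
Section Semistar.
Variable D : idomainType.
Local Notation K := {fraction D}.
Implicit Types (E F : set K) (I P : set D).

Definition to_K I : set K := @tofrac D @` I.

(* The intersection of E with D, as a subset of D. *)
Definition cap_D E : set D := @tofrac D @^-1` E.

Definition is_submod E : Prop :=
  [/\ E 0, forall x y, E x -> E y -> E (x + y)
    & forall a x, E x -> E (tofrac a * x)].

Definition nz_submod : set (set K) :=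
  [set E | is_submod E /\ E <> [set 0]].

Definition fg_submod : set (set K) :=
  [set F | nz_submod F /\ exists (n : nat) (g : 'I_n -> K),
    F = [set x | exists a : 'I_n -> D, x = \sum_(i < n) tofrac (a i) * g i]].

(* Operations are total functions on subsets of K; only their values on
   nz_submod are constrained or compared. *)
Implicit Types star : set K -> set K.

Definition semistar star : Prop :=
  [/\ forall E, nz_submod E -> nz_submod (star E),
      forall x E, x != 0 -> nz_submod E ->
        star (( *%R x) @` E) = ( *%R x) @` star E,
      forall E F, nz_submod E -> nz_submod F -> E `<=` F -> star E `<=` star F,
      forall E, nz_submod E -> E `<=` star E
    & forall E, nz_submod E -> star (star E) = star E].

Definition star_eq star1 star2 : Prop :=
  forall E, nz_submod E -> star1 E = star2 E.

Definition star_le star1 star2 : Prop :=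
  forall E, nz_submod E -> star1 E `<=` star2 E.

Definition star_id : set K -> set K := fun E => E.

Definition semi_star star : Prop :=
  semistar star /\ star (to_K setT) = to_K setT.

Definition stable star : Prop :=
  forall E F, nz_submod E -> nz_submod F -> E `&` F <> [set 0] ->
    star (E `&` F) = star E `&` star F.

Definition star_f star : set K -> set K :=
  fun E => \bigcup_(F in [set F | fg_submod F /\ F `<=` E]) star F.

Definition finite_type star : Prop := star_eq star (star_f star).

Definition quasi_ideal star : set (set D) :=
  [set I | [/\ is_ideal I, I <> [set 0] & cap_D (star (to_K I)) = I]].

Definition QMax star : set (set D) :=
  [set M | [/\ quasi_ideal star M, M <> setT
    & forall I, quasi_ideal star I -> I <> setT -> M `<=` I -> I = M]].

Definition local_ring P : set K :=
  [set x | exists a s : D, ~ P s /\ x = tofrac a / tofrac s].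

(* The product E F: all finite sums of products of an element of E and an
   element of F. *)
Definition submod_mul E F : set K :=
  [set x | exists (n : nat) (e f : 'I_n -> K),
    (forall i, E (e i) /\ F (f i)) /\ x = \sum_(i < n) e i * f i].

(* An empty intersection is setT, that is, K. *)
Definition star_tilde star : set K -> set K :=
  fun E => \bigcap_(P in QMax (star_f star)) submod_mul E (local_ring P).

(* E[Y]_S as a subset of K(Y) = {fraction {poly K}}, for S a subset of D[Y]
   (S is mapped coefficientwise into K[Y]). *)
Definition poly_loc (S : set {poly D}) E : set {fraction {poly K}} :=
  [set z | exists (f : {poly K}) (s : {poly D}),
    [/\ f \is a polyOver [in E], S s
      & z = tofrac f / tofrac (map_poly (@tofrac D) s)]].

(* E[Y]_S `&` K, as a subset of K. *)
Definition poly_loc_cap (S : set {poly D}) E : set K :=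
  [set x | poly_loc S E (tofrac x%:P)].

(* D[Y] minus the union of the Q[Y] for Q in Q_set. *)
Definition poly_avoid (Q_set : set (set D)) : set {poly D} :=
  ~` \bigcup_(Q in Q_set) [set p | p \is a polyOver [in Q]].

End Semistar.

Section PolynomialExtension.
Variable D : idomainType.
Local Notation K := {fraction D}.
Local Notation D1 := {poly D}.
(* The field K(X), as the quotient field of D[X]. *)
Local Notation K1 := {fraction {poly D}}.
Variable star : set K -> set K.

Definition contr (Q : set D1) : set D := polyC @^-1` Q.

Definition extX (P : set D) : set D1 := [set p | p \is a polyOver [in P]].

Definition contr_proper (Q : set D1) : Prop :=
  star_f star (to_K (contr Q)) `<` star (to_K setT).

Definition Theta : set (set D1) :=
  [set Q | Spec Q /\ (contr Q = [set 0] \/ contr_proper Q)].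

Definition star_X : set K1 -> set K1 := poly_loc_cap (poly_avoid Theta).

Definition Delta : set (set D1) :=
  [set Q | Spec Q /\
    (contr Q = [set 0] \/ (Q = extX (contr Q) /\ contr_proper Q))].

Definition star_bracket : set K1 -> set K1 := poly_loc_cap (poly_avoid Delta).

End PolynomialExtension.

(* Main.v *)
(* Clearing denominators, x lies in E^star[X] iff some finite subset l of D[X]
   contained in no prime of Theta satisfies l x <= E. Pairwise products of such
   finite sets are again of this kind, so any operation of this form, for any set
   of primes containing (0), is a stable semistar operation of finite type.
   That tilde changes nothing follows from Zorn's lemma: an ideal I with 1 not in
   I^(star_f) lies in some P in QMax(star_f), and such P are prime. The same fact
   shows that 1 is in I^(star_f) iff it is in I^(tilde star)_f, so Theta is the
   same for star, star_f and tilde star, and that Theta is all of Spec(D[X]) when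
   star is the identity.
   If D^star = D and l x <= D[X], the primes of D[X] contracting to (0) force x
   to lie in K[X], and the primes P[X] with P in QMax(star_f) force the
   coefficients of x into every D_P, hence into D^(tilde star) <= D^star = D. *)
Require Import Defs.
From HB Require Import structures.
From mathcomp Require Import all_boot all_order all_algebra generic_quotient.
From mathcomp Require Import boolp classical_sets.

Set Implicit Arguments.
Unset Strict Implicit.
Unset Printing Implicit Defensive.

Section SemistarTheory.
Import GRing.Theory FracField.
Local Open Scope ring_scope.
Local Open Scope classical_set_scope.
Variable D : idomainType.
Local Notation K := {fraction D}.
Local Notation frac := (@tofrac D).
Implicit Types (E F : set K) (I J P : set D) (star : set K -> set K).
Implicit Types (a b c : D) (x y : K) (s t : seq K).

(** * Submodules and operations of finite type *)

Lemma frac_surj x : exists a b, b != 0 /\ x = frac a / frac b.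
Proof.
elim/quotW: x => r; have d0 := denom_ratioP r; exists r.1, r.2; split=> //.
unlock tofrac; rewrite -[_^-1]pi_inv -[RHS]pi_mul /invf /mulf /=.
by rewrite !numden_Ratio ?oner_eq0 ?mulr1 ?mul1r ?Ratio_numden.
Qed.

Lemma submod0 E : is_submod E -> E 0.
Proof. by case. Qed.

Lemma submodD E x y : is_submod E -> E x -> E y -> E (x + y).
Proof. by case=> _ ED _; apply: ED. Qed.

Lemma submodZ E a x : is_submod E -> E x -> E (frac a * x).
Proof. by case=> _ _; apply. Qed.

Lemma submod_sum E n (f : 'I_n -> K) :
  is_submod E -> (forall i, E (f i)) -> E (\sum_(i < n) f i).
Proof.
move=> smE Ef; elim/big_ind: _ => //; first exact: submod0.
by move=> ? ?; apply: submodD.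
Qed.

Lemma nz_submodP E : nz_submod E <-> is_submod E /\ exists2 x, E x & x != 0.
Proof.
split=> -[smE]; last by case=> x Ex x0; split=> // E0; move: Ex x0;
  rewrite E0 => ->; rewrite eqxx.
move=> nE; split=> //; apply: contrapT => h; apply: nE; apply/seteqP; split.
  by move=> x Ex; apply: contrapT => /eqP x0; apply: h; exists x.
by move=> _ ->; apply: submod0.
Qed.

Lemma nz_submod_sub E F : is_submod F -> nz_submod E -> E `<=` F -> nz_submod F.
Proof.
move=> smF /nz_submodP[_ [x Ex x0]] EF; apply/nz_submodP; split=> //.
by exists x => //; apply: EF.
Qed.

(** Taken as the intersection of all submodules containing [s], so that inclusions follow by
    minimality; [submod_span_codom] identifies it with the linear combinations used in
    [fg_submod]. *)
Definition submod_span s : set K :=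
  [set x | forall E, is_submod E -> (forall y, y \in s -> E y) -> E x].

Lemma submod_span_submod s : is_submod (submod_span s).
Proof.
split=> [E smE _|x y sx sy E smE sE|a x sx E smE sE]; first exact: submod0.
  by apply: submodD => //; [apply: sx|apply: sy].
by apply: submodZ => //; apply: sx.
Qed.

Lemma mem_submod_span s y : y \in s -> submod_span s y.
Proof. by move=> ys E _; apply. Qed.

Lemma submod_span_min s E : is_submod E -> (forall y, y \in s -> E y) ->
  submod_span s `<=` E.
Proof. by move=> smE sE x; apply. Qed.

Lemma nz_submod_span s y : y \in s -> y != 0 -> nz_submod (submod_span s).
Proof.
move=> ys y0; apply/nz_submodP; split; first exact: submod_span_submod.
by exists y => //; apply: mem_submod_span.
Qed.

Lemma submod_span_codom n (g : 'I_n -> K) :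
  [set x | exists a : 'I_n -> D, x = \sum_(i < n) frac (a i) * g i]
  = submod_span (codom g).
Proof.
apply/seteqP; split.
  move=> _ [a ->] E smE gE; apply: submod_sum => // i; apply: submodZ => //.
  by apply: gE; apply: codom_f.
apply: submod_span_min => [|y /codomP[i ->]]; first split.
- exists (fun=> 0); rewrite big1 // => i _.
  by rewrite tofrac0 mul0r.
- move=> _ _ [a ->] [b ->]; exists (fun i => a i + b i).
  by rewrite -big_split; apply: eq_bigr => i _; rewrite tofracD mulrDl.
- move=> a _ [b ->]; exists (fun i => a * b i).
  by rewrite mulr_sumr; apply: eq_bigr => i _; rewrite tofracM mulrA.
exists (fun j => (j == i)%:R).
rewrite (bigD1 i) //= eqxx tofrac1 mul1r big1 ?addr0 // => j /negbTE->.
by rewrite tofrac0 mul0r.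
Qed.

Lemma fg_submodP F : fg_submod F <-> nz_submod F /\ exists s, F = submod_span s.
Proof.
split=> [[nF [n [g Fg]]]|[nF [s Fs]]].
  by split=> //; exists (codom g); rewrite -submod_span_codom.
rewrite Fs in nF *; split=> //; exists (size s), (tnth (in_tuple s)).
by rewrite submod_span_codom codomE map_tnth_enum.
Qed.

Lemma star_fP star E x : is_submod E -> star_f star E x <->
  exists s, [/\ forall y, y \in s -> E y, nz_submod (submod_span s)
              & star (submod_span s) x].
Proof.
move=> smE; split.
  case=> F [/fg_submodP[nF [s Fs]] FE] Fx; exists s; rewrite -Fs; split=> //.
  by move=> y ys; apply: FE; rewrite Fs; apply: mem_submod_span.
case=> s [sE ns sx]; exists (submod_span s) => //; split;
  last exact: submod_span_min.
by apply/fg_submodP; split=> //; exists s.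
Qed.

Lemma star_f_mono star E F : E `<=` F -> star_f star E `<=` star_f star F.
Proof. by move=> EF x [G [fgG GE] Gx]; exists G => //; split=> // y /GE/EF. Qed.

Section Operation.
Variables (star : set K -> set K) (star_semi : semistar star).

Lemma semi_nz E : nz_submod E -> nz_submod (star E).
Proof. by case: star_semi => h _ _ _ _; apply: h. Qed.
Lemma semi_submod E : nz_submod E -> is_submod (star E).
Proof. by case/semi_nz. Qed.
Lemma semi_mul E x y : x != 0 -> nz_submod E -> star E y ->
  star (( *%R x) @` E) (x * y).
Proof. by case: star_semi => _ h _ _ _ x0 nE Ey; rewrite h //; exists y. Qed.
Lemma semi_mono E F : nz_submod E -> nz_submod F -> E `<=` F ->
  star E `<=` star F.
Proof. by case: star_semi => _ _ h _ _; apply: h. Qed.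
Lemma semi_ext E : nz_submod E -> E `<=` star E.
Proof. by case: star_semi => _ _ _ h _; apply: h. Qed.
Lemma semi_idem E : nz_submod E -> star (star E) = star E.
Proof. by case: star_semi => _ _ _ _ h; apply: h. Qed.

Lemma semi_min E F : nz_submod E -> nz_submod F -> E `<=` star F ->
  star E `<=` star F.
Proof.
move=> nE nF EF; rewrite -(semi_idem nF); apply: semi_mono => //.
exact: semi_nz.
Qed.

Lemma star_f_span s : nz_submod (submod_span s) ->
  star_f star (submod_span s) = star (submod_span s).
Proof.
move=> ns; apply/seteqP; split=> x; last first.
  move=> sx; apply/star_fP; first exact: submod_span_submod.
  by exists s; split=> // y; apply: mem_submod_span.
case/star_fP; first exact: submod_span_submod.
move=> t [ts nt]; apply: semi_mono => //; apply: submod_span_min => //.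
exact: submod_span_submod.
Qed.

(** Each element of [s] needs only a finite part of [E], and concatenating these parts serves all
    elements at once. The module structure and the idempotence of [star_f star] come from this. *)
Lemma star_f_absorb E s : nz_submod E -> (forall y, y \in s ->
  star_f star E y) ->
  exists t, [/\ forall y, y \in t -> E y, nz_submod (submod_span t)
              & submod_span s `<=` star (submod_span t)].
Proof.
move=> /nz_submodP[smE [e Ee e0]] sE.
suff [t [tE nt ts]] : exists t, [/\ forall y, y \in t ->
  E y, nz_submod (submod_span t)
    & forall y, y \in s -> star (submod_span t) y].
  by exists t; split=> //; apply: submod_span_min => //; apply: semi_submod.
elim: s sE => [|x s IH] sE.
  (* Even for empty [s] the span of [t] has to be nonzero, so a nonzero [e] of [E] is the first
     generator. *)
  exists [:: e]; split=> //; first by move=> y; rewrite mem_seq1 => /eqP->.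
  by apply: (@nz_submod_span _ e); rewrite ?mem_seq1.
case: IH => [y ys|t [tE nt ts]]; first by apply: sE; rewrite in_cons ys orbT.
have /(star_fP _ _ smE)[u [uE nu ux]] := sE x (mem_head _ _).
have subl : submod_span t `<=` submod_span (t ++ u).
  apply: submod_span_min; first exact: submod_span_submod.
  by move=> y yt; apply: mem_submod_span; rewrite mem_cat yt.
have subr : submod_span u `<=` submod_span (t ++ u).
  apply: submod_span_min; first exact: submod_span_submod.
  by move=> y yt; apply: mem_submod_span; rewrite mem_cat yt orbT.
have nU := nz_submod_sub (submod_span_submod (t ++ u)) nt subl.
exists (t ++ u); split=> //.
  by move=> y; rewrite mem_cat => /orP[/tE|/uE].
move=> y; rewrite in_cons => /orP[/eqP->|/ts].
  exact: (semi_mono nu nU subr) ux.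
exact: (semi_mono nt nU subl).
Qed.

Lemma nz_scale E x : x != 0 -> nz_submod E -> nz_submod (( *%R x) @` E).
Proof.
move=> x0 /nz_submodP[smE [e Ee e0]]; apply/nz_submodP; split; first split.
- by exists 0; rewrite ?mulr0 //; apply: submod0.
- by move=> _ _ [y Ey <-] [z Ez <-]; exists (y + z); rewrite ?mulrDr //;
    apply: submodD.
- by move=> a _ [y Ey <-]; exists (frac a * y); rewrite ?(mulrCA x) //;
    apply: submodZ.
- by exists (x * e); [exists e|rewrite mulf_neq0].
Qed.

Lemma star_f_scale E x y : x != 0 -> nz_submod E -> star_f star E y ->
  star_f star (( *%R x) @` E) (x * y).
Proof.
move=> x0 nE [F [/fg_submodP[nF [s Fs]] FE] Fy].
exists (( *%R x) @` F); last exact: semi_mul.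
split; last by move=> _ [z Fz <-]; exists z => //; apply: FE.
apply/fg_submodP; split; first exact: nz_scale.
exists [seq x * z | z <- s]; apply/seteqP; split.
  move=> _ [z Fz <-] G smG sG; move: z Fz; rewrite Fs.
  (* The elements that [x] multiplies into [G] form a submodule, so it is enough that they include
     the generators of [F]. *)
  apply: (submod_span_min (E := [set z | G (x * z)])); last first.
    by move=> w ws; apply: sG; apply: map_f.
  split=> [|u v|a u] /=; rewrite ?mulr0 ?mulrDr ?(mulrCA x).
  - exact: submod0.
  - exact: submodD.
  - exact: submodZ.
apply: submod_span_min; first by case: (nz_scale x0 nF).
by move=> _ /mapP[z zs ->]; exists z => //; rewrite Fs; apply: mem_submod_span.
Qed.

Lemma star_f_ext E : nz_submod E -> E `<=` star_f star E.
Proof.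
move=> /nz_submodP[smE [e Ee e0]] x Ex; apply/star_fP => //.
have nexs : nz_submod (submod_span [:: e; x]) by apply: nz_submod_span e0;
  rewrite mem_head.
exists [:: e; x]; split=> //.
  by move=> y; rewrite !inE => /orP[] /eqP->.
by apply: semi_ext => //; apply: mem_submod_span; rewrite !inE eqxx orbT.
Qed.

Lemma star_f_submod E : nz_submod E -> is_submod (star_f star E).
Proof.
move=> nE; have [smE _] := nE.
have key s y : (forall x, x \in s -> star_f star E x) -> submod_span s y ->
  star_f star E y.
  move=> sE sy; have [t [tE nt st]] := star_f_absorb nE sE.
  by apply/star_fP => //; exists t; split=> //; apply: st.
split.
- by apply: star_f_ext => //; apply: submod0.
- move=> x y Ex Ey; apply: (key [:: x; y]); last first.
    by apply: (submodD (submod_span_submod _)); apply: mem_submod_span;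
      rewrite !inE eqxx ?orbT.
  by move=> z; rewrite !inE => /orP[] /eqP->.
- move=> a x Ex; apply: (key [:: x]); last first.
    by apply: (submodZ _ (submod_span_submod _)); apply: mem_submod_span;
      rewrite mem_head.
  by move=> z; rewrite inE => /eqP->.
Qed.

Lemma star_f_semistar : semistar (star_f star).
Proof.
have nf E : nz_submod E -> nz_submod (star_f star E).
  by move=> nE; apply: nz_submod_sub (star_f_submod nE) nE (star_f_ext nE).
split=> //.
- move=> x E x0 nE; apply/seteqP; split=> y; last first.
    by case=> z Ez <-; apply: star_f_scale.
  (* The remaining inclusion is scaling by [x^-1], applied to the submodule xE. *)
  move=> xEy; exists (x^-1 * y); last by rewrite mulVKf.
  have -> : E = ( *%R x^-1) @` (( *%R x) @` E).
    apply/seteqP; split=> [z Ez|_ [_ [z Ez <-] <-]]; last by rewrite mulKf.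
    by exists (x * z); [exists z|rewrite mulKf].
  by apply: star_f_scale; rewrite ?invr_eq0 //; apply: nz_scale.
- by move=> E F _ _; apply: star_f_mono.
- exact: star_f_ext.
- move=> E nE; have [smE _] := nE; apply/seteqP; split;
    last exact/star_f_ext/nf.
  move=> x /star_fP[|s [sE ns sx]]; first exact: star_f_submod.
  have [t [tE nt st]] := star_f_absorb nE sE.
  by apply/star_fP => //; exists t; split=> //; apply: semi_min sx.
Qed.

End Operation.

(** * Maximal quasi-ideals *)

Lemma ideal_one I : is_ideal I -> I 1 -> I = setT.
Proof.
by move=> [_ _ IM] I1; apply/seteqP; split=> // a _; rewrite -(mulr1 a);
  apply: IM.
Qed.

Lemma Spec_one P : Spec P -> ~ P 1.
Proof. by case=> iP PT _ /(ideal_one iP). Qed.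

Lemma Spec_mul P a b : Spec P -> P (a * b) -> P a \/ P b.
Proof.
case=> _ _ pP /mem_set Pab.
by case/orP: (pP _ _ Pab) => /set_mem; [left|right].
Qed.

Lemma Spec_mulN P a b : Spec P -> ~ P a -> ~ P b -> ~ P (a * b).
Proof. by move=> sP Pa Pb /(Spec_mul sP)[]. Qed.

Lemma Spec_set0 : @Spec D [set 0].
Proof.
split; first split=> //= [x y -> ->|a x ->]; rewrite ?addr0 ?mulr0 //.
  move=> /seteqP[_ /(_ 1 I)] /eqP; by rewrite oner_eq0.
move=> u v /set_mem/eqP; rewrite mulf_eq0 => /orP[] /eqP->; apply/orP.
  by left; rewrite inE.
by right; rewrite inE.
Qed.

Lemma to_KE I a : to_K I (frac a) <-> I a.
Proof.
split=> [[b Ib /eqP]|Ia]; last by exists a.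
by rewrite tofrac_eq => /eqP <-.
Qed.

Lemma to_K_mono I J : I `<=` J -> to_K I `<=` to_K J.
Proof. exact: image_subset. Qed.

Lemma to_K_submod I : is_ideal I -> is_submod (to_K I).
Proof.
move=> [I0 ID IM]; split.
- by exists 0; rewrite ?tofrac0.
- by move=> _ _ [a Ia <-] [b Ib <-]; exists (a + b); rewrite ?tofracD //;
    apply: ID.
- by move=> a _ [b Ib <-]; exists (a * b); rewrite ?tofracM //; apply: IM.
Qed.

Lemma nz_ideal I : is_ideal I -> I <> [set 0] -> exists2 a, I a & a != 0.
Proof.
move=> [I0 _ _] nI; apply: contrapT => h; apply: nI; apply/seteqP; split.
  by move=> a Ia; apply: contrapT => /eqP a0; apply: h; exists a.
by move=> _ ->.
Qed.

Lemma nz_idealP I a : I a -> a != 0 -> I <> [set 0].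
Proof. by move=> Ia /eqP a0 I0; apply: a0; move: Ia; rewrite I0. Qed.

Lemma nz_ideal_sub I J : is_ideal I -> I <> [set 0] -> I `<=` J -> J <> [set 0].
Proof. by move=> iI /(nz_ideal iI)[a Ia a0] /(_ a Ia) /nz_idealP; apply. Qed.

Lemma to_K_nz I : is_ideal I -> I <> [set 0] -> nz_submod (to_K I).
Proof.
move=> iI nI; apply/nz_submodP; split; first exact: to_K_submod.
have [a Ia a0] := nz_ideal iI nI.
by exists (frac a); rewrite ?tofrac_eq0 //; apply/to_KE.
Qed.

Lemma to_KT_nz : nz_submod (to_K [set: D]).
Proof. by apply: to_K_nz => //; apply: (@nz_idealP _ 1) => //;
  rewrite oner_eq0. Qed.

Lemma to_KT_span : to_K [set: D] = submod_span [:: 1].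
Proof.
apply/seteqP; split.
  move=> _ [a _ <-]; rewrite -[frac a]mulr1;
    apply: (submodZ _ (submod_span_submod _)).
  by apply: mem_submod_span; rewrite mem_head.
apply: submod_span_min; first exact: to_K_submod.
by move=> y; rewrite inE => /eqP->; exists 1; rewrite ?tofrac1.
Qed.

Lemma to_KT_sub E : is_submod E -> E 1 -> to_K setT `<=` E.
Proof.
move=> smE E1; rewrite to_KT_span; apply: submod_span_min => // y.
by rewrite inE => /eqP->.
Qed.

Lemma cap_ideal E : is_submod E -> is_ideal (cap_D E).
Proof.
move=> smE; rewrite /cap_D; split=> [|a b Ea Eb|a b Eb] /=.
- by rewrite tofrac0; apply: submod0.
- by rewrite tofracD; apply: submodD.
- by rewrite tofracM; apply: submodZ.
Qed.

Lemma to_K_cap E : to_K (cap_D E) `<=` E.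
Proof. by move=> _ [a Ea <-]. Qed.

Section Quasi.
Variables (star : set K -> set K) (star_semi : semistar star).

Lemma sub_cap I : is_ideal I -> I <> [set 0] -> I `<=` cap_D (star (to_K I)).
Proof.
move=> iI nI a Ia; apply: (semi_ext star_semi); first exact: to_K_nz.
exact/to_KE.
Qed.

Lemma quasi_cap I : is_ideal I -> I <> [set 0] ->
  quasi_ideal star (cap_D (star (to_K I))).
Proof.
move=> iI nI; have nK := to_K_nz iI nI.
have iC : is_ideal (cap_D (star (to_K I))) by apply/cap_ideal/semi_submod.
have nC : cap_D (star (to_K I)) <> [set 0].
  exact: nz_ideal_sub iI nI (sub_cap iI nI).
split=> //; apply/seteqP; split; last exact: sub_cap.
move=> a; apply: (semi_min star_semi _ nK); first exact: to_K_nz.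
exact: to_K_cap.
Qed.

Lemma QMax_one P : QMax star P -> ~ star (to_K P) 1.
Proof.
case=> -[iP nP cP] PT _ P1; apply: PT; apply: ideal_one => //.
by rewrite -cP /cap_D /= tofrac1.
Qed.

(* If [a] is not in the maximal quasi-ideal [P], then [1] is in [(P + aD)^star],
   so [b] is in [(bP + abD)^star], which is contained in [P^star]. *)
Lemma QMax_Spec P : QMax star P -> Spec P.
Proof.
move=> QP; have [[iP nP cP] PT maxP] := QP; split=> // a b /set_mem Pab.
have [Pa|Pa] := pselect (P a); first by rewrite mem_set.
rewrite orbC; have [->|b0] := eqVneq b 0; first by rewrite mem_set //; case: iP.
have [P0 PD PM] := iP.
pose J : set D := [set c | exists p r, P p /\ c = p + r * a].
have iJ : is_ideal J.
  split.
  - by exists 0, 0; rewrite mul0r addr0.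
  - move=> _ _ [p [r [Pp ->]]] [q [u [Pq ->]]]; exists (p + q), (r + u).
    by rewrite mulrDl addrACA; split=> //; apply: PD.
  - move=> c _ [p [r [Pp ->]]]; exists (c * p), (c * r).
    by rewrite mulrDr mulrA; split=> //; apply: PM.
have PJ : P `<=` J by move=> p Pp; exists p, 0; rewrite mul0r addr0.
have nJ := nz_ideal_sub iP nP PJ.
have qJ := quasi_cap iJ nJ.
have JC := sub_cap iJ nJ.
have CT : cap_D (star (to_K J)) = setT.
  apply: contrapT => CT; apply: Pa.
  rewrite -(maxP _ qJ CT (subset_trans PJ JC)).
  by apply: JC; exists 0, 1; rewrite mul1r add0r.
have J1 : star (to_K J) 1.
  have : cap_D (star (to_K J)) 1 by rewrite CT.
  by rewrite /cap_D /= tofrac1.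
have fb0 : frac b != 0 by rewrite tofrac_eq0.
have nKJ := to_K_nz iJ nJ; have nKP := to_K_nz iP nP.
have bJ : star (( *%R (frac b)) @` to_K J) (frac b).
  by rewrite -[X in star _ X]mulr1; apply: semi_mul.
rewrite mem_set // -cP; apply: (semi_mono star_semi) bJ => //.
  exact: nz_scale.
move=> _ [_ [_ [p [r [Pp ->]]] <-] <-].
rewrite -tofracM; apply/to_KE; rewrite mulrDr; apply: PD; first exact: PM.
by rewrite mulrCA [b * a]mulrC; apply: PM.
Qed.

End Quasi.

(** Zorn's lemma on the ideals containing [I] whose [star_f] closure omits 1. Unions of chains keep
    this property because membership in a [star_f] closure involves finitely many generators, which
    lie in one member of the chain. *)
Lemma exists_QMax star I : semistar star -> is_ideal I -> I <> [set 0] ->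
  ~ star_f star (to_K I) 1 ->
  exists2 P, QMax (star_f star) P & I `<=` P.
Proof.
move=> star_semi iI nI I1; have fsemi := star_f_semistar star_semi.
pose nice J := [/\ is_ideal J, I `<=` J & ~ star_f star (to_K J) 1].
have niceI : nice I by split.
have niceN J : nice J -> J <> [set 0] by case=> _ /(nz_ideal_sub iI nI).
have [A [[A0|nA] maxA]] : exists A, (A = set0 \/ nice A) /\
    forall B, A `<` B -> ~ (B = set0 \/ nice B).
- apply: (@Zorn_bigcup D (fun J => J = set0 \/ nice J)) => F FP Ftot.
  have [[B FB nB]|noB] := pselect (exists2 B, F B & nice B); last first.
    left; apply/seteqP; split=> // a [B FB Ba].
    case: (FP _ FB) => [B0|nB]; first by rewrite B0 in Ba.
    by case: noB; exists B.
  right; set U := \bigcup_(X in F) X.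
  have niceF C a : F C -> C a -> nice C.
    by move=> FC Ca; case: (FP _ FC) => // C0; move: Ca; rewrite C0.
  have [iB IB _] := nB; have [B0 _ _] := iB.
  have iU : is_ideal U.
    split.
    + by exists B.
    + move=> a b [C1 FC1 Ca] [C2 FC2 Cb].
      have [s12|s21] := Ftot _ _ FC1 FC2.
        have [[_ h _] _ _] := niceF _ _ FC2 Cb.
        by exists C2 => //; apply: h => //; apply: s12.
      have [[_ h _] _ _] := niceF _ _ FC1 Ca.
      by exists C1 => //; apply: h => //; apply: s21.
    + move=> a b [C FC Cb]; have [[_ _ h] _ _] := niceF _ _ FC Cb.
      by exists C => //; apply: h.
  split=> //; first by move=> a Ia; exists B => //; apply: IB.
  move=> /(star_fP _ _ (to_K_submod iU))[s [sU ns s1]].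
  suff [C [FC nC sC]] : exists C, [/\ F C, nice C & forall y, y \in s ->
    to_K C y].
    have [iC _] := nC; apply; apply/star_fP; first exact: to_K_submod.
    by exists s.
  elim: s sU {ns s1} => [_|x s IH sU]; first by exists B.
  case: IH => [y ys|C [FC nC sC]]; first by apply: sU; rewrite in_cons ys orbT.
  have [a [C' FC' C'a] ax] := sU x (mem_head _ _).
  have nC' := niceF _ _ FC' C'a.
  have [sCC'|sC'C] := Ftot _ _ FC FC'.
    exists C'; split=> // y; rewrite in_cons => /orP[/eqP->|/sC].
      by exists a.
    exact: to_K_mono.
  exists C; split=> // y; rewrite in_cons => /orP[/eqP->|/sC//].
  by exists a => //; apply: sC'C.
- case: (maxA I); last by right.
  rewrite A0; split=> // /(_ 0); case: iI => I0 _ _; exact.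
have [iA IA A1] := nA; have nzA := niceN _ nA.
have maxA' B : nice B -> A `<=` B -> B = A.
  move=> nB AB; apply: contrapT => BA; apply: (maxA B); last by right.
  by split=> // BA'; apply: BA; apply/seteqP.
have nKA := to_K_nz iA nzA.
exists A => //; split.
(* By idempotence the trace on [D] of the closure of [A] is again in the family, so it equals [A] by
   maximality. *)
- split=> //; apply: maxA'; last exact: (sub_cap fsemi).
  have iC := cap_ideal (star_f_submod star_semi nKA).
  split=> //; first exact: subset_trans IA (sub_cap fsemi iA nzA).
  have nzC := nz_ideal_sub iA nzA (sub_cap fsemi iA nzA).
  by move/(semi_min fsemi (to_K_nz iC nzC) nKA (@to_K_cap _)).
- by move=> AT; apply: A1; rewrite AT; apply: (semi_ext fsemi to_KT_nz);
    exists 1; rewrite ?tofrac1.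
- move=> J [iJ nJ cJ] JT AJ; apply: maxA' => //; split=> //.
    exact: subset_trans AJ.
  move=> J1; apply: JT; apply: ideal_one => //.
  by rewrite -cJ /cap_D /= tofrac1.
Qed.

(** * The stable operation of finite type below an operation *)

(** The ideal (E : x) of [D]. It turns questions on elements into questions on ideals: x lies in E
    D_P exactly when (E : x) is not contained in P. *)
Definition colon E x : set D := [set r | E (frac r * x)].

Lemma colon_ideal E x : is_submod E -> is_ideal (colon E x).
Proof.
move=> smE; rewrite /colon; split=> [|a b Ea Eb|a b Eb] /=.
- by rewrite tofrac0 mul0r; apply: submod0.
- by rewrite tofracD mulrDl; apply: submodD.
- by rewrite tofracM -mulrA; apply: submodZ.
Qed.

(** With x = a/b and a nonzero e = c/d in [E], the nonzero element bc works, since bc x = ad e. *)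
Lemma colon_nz E x : nz_submod E -> colon E x <> [set 0].
Proof.
move=> /nz_submodP[smE [e Ee e0]].
have [a [b [b0 xE]]] := frac_surj x; have [c [d [d0 eE]]] := frac_surj e.
have fb0 : frac b != 0 by rewrite tofrac_eq0.
have fd0 : frac d != 0 by rewrite tofrac_eq0.
have c0 : c != 0 by apply: contra_neq e0 => c0; rewrite eE c0 tofrac0 mul0r.
apply: (@nz_idealP _ (b * c)); last by rewrite mulf_neq0.
rewrite /colon /=.
have -> : frac (b * c) * x = frac (a * d) * e.
  rewrite xE eE !tofracM (mulrC (frac b)) -!mulrA (mulrC (frac b)) divfK //.
  by rewrite (mulrC (frac d)) divfK // mulrC.
exact: submodZ.
Qed.

(** A finite sum of elements of [E] divided by elements outside [P] has the product of these as a
    common denominator, still outside [P] by primality. *)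
Lemma submod_mul_localP P E x : Spec P -> is_submod E ->
  submod_mul E (local_ring P) x <-> exists c, ~ P c /\ E (frac c * x).
Proof.
move=> sP smE; split=> [[n [e [f [ef ->]]]]|[c [Pc Ecx]]]; last first.
  have c0 : frac c != 0.
    by rewrite tofrac_eq0; apply/eqP=> c0; apply: Pc; rewrite c0;
      case: sP => -[].
  exists 1%N, (fun=> frac c * x), (fun=> (frac c)^-1); split.
    by move=> _; split=> //; exists 1, c; rewrite tofrac1 div1r.
  by rewrite big_ord1 mulrAC mulfV // mul1r.
elim/big_ind: _ => [|y z [c [Pc Ey]] [d [Pd Ez]]|i _].
- by exists 1; rewrite mulr0; split; [exact: Spec_one|exact: submod0].
- exists (c * d); split; first exact: Spec_mulN.
  rewrite mulrDr; apply: submodD => //; last by rewrite tofracM -mulrA;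
    apply: submodZ.
  by rewrite [c * d]mulrC tofracM -mulrA; apply: submodZ.
- have [Ee [a [c [Pc fE]]]] := ef i; exists c; split=> //.
  have c0 : frac c != 0.
    by rewrite tofrac_eq0; apply/eqP=> c0; apply: Pc; rewrite c0;
      case: sP => -[].
  by rewrite mulrCA fE [frac c * _]mulrC divfK // mulrC; apply: submodZ.
Qed.

Lemma star_tildeP star E x : semistar star -> is_submod E ->
  star_tilde star E x <->
  forall P, QMax (star_f star) P -> exists c, ~ P c /\ E (frac c * x).
Proof.
move=> star_semi smE; have fsemi := star_f_semistar star_semi.
by split=> h P QP; apply/(submod_mul_localP _ (QMax_Spec fsemi QP) smE)/h.
Qed.

Lemma star_tilde_semistar star : semistar star -> semistar (star_tilde star).
Proof.
move=> star_semi; have fsemi := star_f_semistar star_semi.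
have tildeP := star_tildeP _ star_semi.
have ext E : is_submod E -> E `<=` star_tilde star E.
  move=> smE x Ex; apply/tildeP => // P QP; exists 1.
  by rewrite tofrac1 mul1r; split=> //; apply/Spec_one/(QMax_Spec fsemi QP).
have sm E : is_submod E -> is_submod (star_tilde star E).
  move=> smE; split.
  - by apply: ext => //; apply: submod0.
  - move=> x y /(tildeP _ _ smE) Ex /(tildeP _ _ smE) Ey;
      apply/tildeP => // P QP.
    have [c [Pc Ecx]] := Ex _ QP; have [d [Pd Edy]] := Ey _ QP.
    exists (c * d); split; first exact: Spec_mulN (QMax_Spec fsemi QP) Pc Pd.
    rewrite mulrDr; apply: submodD => //; last by rewrite tofracM -mulrA;
      apply: submodZ.
    by rewrite [c * d]mulrC tofracM -mulrA; apply: submodZ.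
  - move=> a x /(tildeP _ _ smE) Ex; apply/tildeP => // P QP.
    have [c [Pc Ecx]] := Ex _ QP; exists c; split=> //.
    by rewrite mulrCA; apply: submodZ.
split.
- move=> E nE; have [smE _] := nE.
  exact: nz_submod_sub (sm _ smE) nE (ext _ smE).
- move=> x E x0 nE; have [smE _] := nE; have [smxE _] := nz_scale x0 nE.
  apply/seteqP; split=> [y /(tildeP _ _ smxE) h|_ [y /(tildeP _ _ smE) h <-]].
    exists (x^-1 * y); last by rewrite mulVKf.
    apply/tildeP => // P QP; have [c [Pc [z Ez zE]]] := h _ QP.
    by exists c; split=> //; rewrite mulrCA -zE mulKf.
  apply/tildeP => // P QP; have [c [Pc Ecy]] := h _ QP.
  by exists c; split=> //; exists (frac c * y) => //; rewrite mulrCA.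
- move=> E F [smE _] [smF _] EF x /(tildeP _ _ smE) h; apply/tildeP => // P QP.
  by have [c [Pc Ecx]] := h _ QP; exists c; split=> //; apply: EF.
- by move=> E [smE _]; apply: ext.
- move=> E [smE _]; apply/seteqP; split; last exact/ext/sm.
  move=> x /(tildeP _ _ (sm _ smE)) h; apply/tildeP => // P QP.
  have [c [Pc /(tildeP _ _ smE) /(_ _ QP) [d [Pd Ed]]]] := h _ QP.
  exists (d * c); rewrite tofracM -mulrA; split=> //.
  exact: Spec_mulN (QMax_Spec fsemi QP) Pd Pc.
Qed.

Lemma star_f_proper star I : semistar star -> is_ideal I -> I <> [set 0] ->
  star_f star (to_K I) `<` star (to_K setT) <-> ~ star_f star (to_K I) 1.
Proof.
move=> star_semi iI nI; have fsemi := star_f_semistar star_semi.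
(* [D] is generated by 1, so both operations agree on it. *)
have -> : star (to_K setT) = star_f star (to_K setT).
  by rewrite to_KT_span star_f_span // -to_KT_span; exact: to_KT_nz.
split=> [[_ h] I1|I1].
  apply: h; apply: semi_min (to_K_nz iI nI) _ => //; first exact: to_KT_nz.
  by apply: to_KT_sub => //; apply: semi_submod (to_K_nz iI nI).
split; first by apply/star_f_mono/to_K_mono.
move=> h; apply/I1/h/(semi_ext fsemi to_KT_nz).
by exists 1; rewrite ?tofrac1.
Qed.

(** If 1 is in the tilde closure of a finite part of [I] while [I] lies in some P of [QMax], the
    denominator of 1 outside P belongs to [I], a contradiction. Conversely, a finite part of [I]
    with 1 in its [star] closure lies in no such P, and any of its elements outside P is a
    denominator for 1. *)
Lemma star_f_tilde_one star I : semistar star -> is_ideal I -> I <> [set 0] ->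
  star_f (star_tilde star) (to_K I) 1 <-> star_f star (to_K I) 1.
Proof.
move=> star_semi iI nI; have fsemi := star_f_semistar star_semi.
have smI := to_K_submod iI.
split=> /(star_fP _ _ smI)[s [sI ns s1]].
  apply: contrapT => /(exists_QMax star_semi iI nI)[P QP IP].
  have /(_ _ QP)[c [Pc]] := (star_tildeP _ star_semi (submod_span_submod s)).1 s1.
  by move=> /(submod_span_min smI sI); rewrite mulr1 => /to_KE/IP.
apply/star_fP => //; exists s; split=> //.
apply/star_tildeP => //; first exact: submod_span_submod.
move=> P QP; apply: contrapT => h; apply: (QMax_one QP).
have [iP nP _] := QMax_Spec fsemi QP.
apply/star_fP; first exact: to_K_submod.
exists s; split=> // y ys; have [a Ia ay] := sI _ ys.
exists a => //; apply: contrapT => Pa; apply: h; exists a; split=> //.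
by rewrite mulr1 ay; apply: mem_submod_span.
Qed.

(** For nonzero x in the tilde closure, (E : x) lies in no P of [QMax], hence has 1 in its [star_f]
    closure. Multiplying by x gives the claim, as x(E : x) lies in [E]. *)
Lemma star_tilde_le star E : semistar star -> nz_submod E ->
  star_tilde star E `<=` star_f star E.
Proof.
move=> star_semi nE x; have [smE _] := nE;
  have fsemi := star_f_semistar star_semi.
have [->|x0] := eqVneq x 0; first by move=> _;
  exact: submod0 (star_f_submod star_semi nE).
move/(star_tildeP _ star_semi smE) => h.
have iI := colon_ideal x smE; have nI := @colon_nz E x nE.
have I1 : star_f star (to_K (colon E x)) 1.
  apply: contrapT => /(exists_QMax star_semi iI nI)[P QP IP].
  by have [c [Pc /IP]] := h _ QP.
have := star_f_scale star_semi x0 (to_K_nz iI nI) I1.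
rewrite mulr1; apply: star_f_mono => _ [_ [a Ea <-] <-].
by rewrite mulrC.
Qed.

Lemma star_id_semistar : semistar (@star_id D).
Proof. by rewrite /star_id; split=> // E _ x. Qed.

Lemma star_f_id E : is_submod E -> star_f (@star_id D) E `<=` E.
Proof. by move=> smE x [F [_ FE] Fx]; apply: FE. Qed.

(** * Operations defined by localizations of [D[Y]] *)

Lemma polyOver_setP (V : nzRingType) (A : set V) (p : {poly V}) : A 0 ->
  p \is a polyOver [in A] <-> forall i, A p`_i.
Proof.
move=> A0; split=> [/(all_nthP 0) h i|h]; last first.
  by apply/(all_nthP 0) => i _; apply: mem_set.
case: (ltnP i (size p)) => [/h /set_mem//|/(nth_default 0) ->//].
Qed.

Lemma map_frac_inj : injective (map_poly frac).
Proof.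
apply: map_inj_poly; rewrite ?tofrac0 //.
by move=> a b /eqP; rewrite tofrac_eq => /eqP.
Qed.

Lemma map_frac_eq0 (p : {poly D}) : (map_poly frac p == 0) = (p == 0).
Proof. by rewrite -(inj_eq map_frac_inj) map_poly0. Qed.

Section Localization.
Variable L : set (set D).
Hypotheses (L_Spec : L `<=` @Spec D) (L0 : L [set 0]).
Local Notation op := (poly_loc_cap (poly_avoid L)).

(** A polynomial is in [poly_avoid L] exactly when its list of coefficients escapes; this removes
    the indeterminate [Y] from the later arguments. *)
Definition escapes (l : seq D) : Prop :=
  forall Q, L Q -> exists2 c, c \in l & ~ Q c.

Lemma escapes1 : escapes [:: 1].
Proof. by move=> Q /L_Spec/Spec_one Q1; exists 1; rewrite ?mem_head. Qed.

Lemma escapes_allpairs l m : escapes l -> escapes m ->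
  escapes [seq c * d | c <- l, d <- m].
Proof.
move=> el em Q LQ; have [c cl Qc] := el _ LQ; have [d dm Qd] := em _ LQ.
by exists (c * d); [apply: allpairs_f|apply: Spec_mulN (L_Spec LQ) Qc Qd].
Qed.

(** An identity x = f/s in K(Y) means f = xs in K[Y], so cx is in [E] for each coefficient c of s.
    Conversely [Poly l] serves as s. The zero prime in [L] makes these denominators nonzero. *)
Lemma poly_loc_capP E x : is_submod E -> op E x <->
  exists l, escapes l /\ forall c, c \in l -> E (frac c * x).
Proof.
move=> smE; have E0 := submod0 smE; split.
  case=> f [s [/(polyOver_setP _ E0) fE avs xfs]].
  have esc : escapes s.
    move=> Q LQ; apply: contrapT => h; apply: avs; exists Q => //=.
    apply/allP => c cs; apply: mem_set; apply: contrapT => Qc.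
    by apply: h; exists c.
  exists s; split=> // c cs.
  have s0 : map_poly frac s != 0.
    have [d ds d0] := esc _ L0; rewrite map_frac_eq0.
    by apply: contra_notN d0 => /eqP s0; move: ds; rewrite s0 polyseq0.
  have fxs : f = x *: map_poly frac s.
    have: tofrac f = tofrac (x%:P * map_poly frac s).
      by rewrite tofracM xfs divfK // tofrac_eq0.
    by move/eqP; rewrite tofrac_eq mul_polyC => /eqP.
  by rewrite -(nth_index 0 cs) mulrC -coef_map -coefZ -fxs; apply: fE.
move=> [l [el lE]]; exists (x *: map_poly frac (Poly l)), (Poly l); split.
- apply/polyOver_setP => // i; rewrite coefZ coef_map coef_Poly mulrC.
  case: (ltnP i (size l)) => il; first by apply: lE; apply: mem_nth.
  by rewrite nth_default // raddf0 mul0r.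
- case=> Q LQ /(all_nthP 0) h; have [c cl Qc] := el _ LQ; apply: Qc.
  have [Q0 _ _] := (L_Spec LQ).
  have /(polyOver_setP _ _)/(_ (index c l)) : Poly l \is a polyOver [in Q].
    exact/(all_nthP 0).
  by rewrite coef_Poly nth_index //; apply; case: Q0.
- have p0 : map_poly frac (Poly l) != 0.
    have [c cl /eqP c0] := el _ L0; rewrite map_frac_eq0.
    apply: contra_neq c0 => p0.
    by rewrite -(nth_index 0 cl) -coef_Poly p0 coef0.
  by rewrite -mul_polyC tofracM mulfK // tofrac_eq0.
Qed.

Lemma poly_loc_cap_submod E : is_submod E -> is_submod (op E).
Proof.
move=> smE; split.
- apply/poly_loc_capP => //; exists [:: 1]; split=> [|c _];
    first exact: escapes1.
  by rewrite mulr0; apply: submod0.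
- move=> x y /(poly_loc_capP _ smE)[l [el lx]] /(poly_loc_capP _ smE)[m [em my]].
  apply/poly_loc_capP => //; exists [seq c * d | c <- l, d <- m].
  split; first exact: escapes_allpairs.
  move=> _ /allpairsP[[c d] [/= cl dm ->]]; rewrite mulrDr;
    apply: submodD => //.
    by rewrite [c * d]mulrC tofracM -mulrA; apply: submodZ => //; apply: lx.
  by rewrite tofracM -mulrA; apply: submodZ => //; apply: my.
- move=> a x /(poly_loc_capP _ smE)[l [el lx]]; apply/poly_loc_capP => //.
  by exists l; split=> // c cl; rewrite mulrCA; apply: submodZ => //; apply: lx.
Qed.

Lemma poly_loc_cap_ext E : is_submod E -> E `<=` op E.
Proof.
move=> smE x Ex; apply/poly_loc_capP => //; exists [:: 1].
by split=> [|c _]; [exact: escapes1|apply: submodZ].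
Qed.

Lemma poly_loc_cap_nz E : nz_submod E -> nz_submod (op E).
Proof.
move=> nE; have [smE _] := nE.
exact: nz_submod_sub (poly_loc_cap_submod smE) nE (poly_loc_cap_ext smE).
Qed.

Lemma poly_loc_cap_semistar : semistar op.
Proof.
split.
- exact: poly_loc_cap_nz.
- move=> x E x0 nE; have [smE _] := nE; have [smxE _] := nz_scale x0 nE.
  apply/seteqP; split=> [y /(poly_loc_capP _ smxE)|_ [y /(poly_loc_capP _ smE)[l [el lE]] <-]].
    move=> [l [el lE]]; exists (x^-1 * y); last by rewrite mulVKf.
    apply/poly_loc_capP => //; exists l; split=> // c /lE[z Ez zE].
    by rewrite mulrCA -zE mulKf.
  apply/poly_loc_capP => //; exists l; split=> // c cl.
  by exists (frac c * y); [apply: lE|rewrite mulrCA].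
- move=> E F [smE _] [smF _] EF x /(poly_loc_capP _ smE)[l [el lE]].
  by apply/poly_loc_capP => //; exists l; split=> // c cl; apply/EF/lE.
- by move=> E [smE _]; apply: poly_loc_cap_ext.
- move=> E [smE _]; have smO := poly_loc_cap_submod smE.
  apply/seteqP; split; last exact: poly_loc_cap_ext.
  move=> x /(poly_loc_capP _ smO)[l [el lO]]; apply/poly_loc_capP => //.
  (* A single [m] is made to serve all [c] in [l] by multiplying the lists obtained for each [c];
     its products with [l] then witness [x]. *)
  suff [m [em mE]] : exists m, escapes m /\
      forall c d, c \in l -> d \in m -> E (frac d * (frac c * x)).
    exists [seq c * d | c <- l, d <- m]; split; first exact: escapes_allpairs.
    move=> _ /allpairsP[[c d] [/= cl dm ->]].
    by rewrite [c * d]mulrC tofracM -mulrA; apply: mE.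
  elim: l lO {el} => [_|c l IH lO]; first by exists [:: 1]; split;
    [exact: escapes1|].
  have [|m [em mE]] := IH; first by move=> d dl; apply: lO;
    rewrite in_cons dl orbT.
  have /(poly_loc_capP _ smE)[n [en nE]] := lO c (mem_head _ _).
  exists [seq d * e | d <- m, e <- n]; split; first exact: escapes_allpairs.
  move=> b _ bl /allpairsP[[d e] [/= dm en' ->]]; move: bl; rewrite in_cons.
  case/orP => [/eqP->|bl]; last first.
    by rewrite [d * e]mulrC tofracM -mulrA; apply: submodZ => //; apply: mE.
  by rewrite tofracM -mulrA; apply: submodZ => //; apply: nE.
Qed.

(** If [l] is a witness for [E] and [m] for [F], their pairwise products are a witness for the
    intersection. *)
Lemma poly_loc_cap_stable : stable op.
Proof.
move=> E F [smE _] [smF _] _.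
have smEF : is_submod (E `&` F).
  split=> [|x y [Ex Fx] [Ey Fy]|a x [Ex Fx]].
  - by split; apply: submod0.
  - by split; apply: submodD.
  - by split; apply: submodZ.
apply/seteqP; split=> x.
  move=> /(poly_loc_capP _ smEF)[l [el lE]].
  by split; apply/poly_loc_capP => //; exists l; split=> // c /lE[].
move=> [/(poly_loc_capP _ smE)[l [el lE]] /(poly_loc_capP _ smF)[m [em mF]]].
apply/poly_loc_capP => //; exists [seq c * d | c <- l, d <- m].
split; first exact: escapes_allpairs.
move=> _ /allpairsP[[c d] [/= cl dm ->]]; split.
  by rewrite [c * d]mulrC tofracM -mulrA; apply: submodZ => //; apply: lE.
by rewrite tofracM -mulrA; apply: submodZ => //; apply: mF.
Qed.

(** A witness [l] for [x] uses only the elements cx of [E] with c in [l]. They generate a submodule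
    whose closure contains [x], nonzero for nonzero [x] since [l] escapes the zero prime. *)
Lemma poly_loc_cap_finite_type : finite_type op.
Proof.
move=> E nE; have [smE _] := nE; have opS := poly_loc_cap_semistar.
apply/seteqP; split=> x.
  have [-> _|x0] := eqVneq x 0; first by exact: submod0 (star_f_submod opS nE).
  move=> /(poly_loc_capP _ smE)[l [el lE]]; apply/star_fP => //.
  have sm := submod_span_submod [seq frac c * x | c <- l].
  exists [seq frac c * x | c <- l]; split.
  - by move=> _ /mapP[c cl ->]; apply: lE.
  - have [c cl /eqP c0] := el _ L0; apply: (@nz_submod_span _ (frac c * x)).
      exact: map_f.
    by rewrite mulf_neq0 ?tofrac_eq0.
  - apply/poly_loc_capP => //; exists l; split=> // c cl.
    by apply: mem_submod_span; apply: map_f.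
move=> /(star_fP _ _ smE)[s [sE ns]]; apply: (semi_mono opS) => //.
exact: submod_span_min.
Qed.

(** If a witness [l] for [x] lay inside some P of [QMax], the same [l] would put 1 in the closure of
    P. So some c in [l] is outside P, and it is a denominator showing that x lies in E D_P. *)
Lemma poly_loc_cap_tilde : star_eq (star_tilde op) op.
Proof.
move=> E nE; have [smE _] := nE; have opS := poly_loc_cap_semistar.
apply/seteqP; split.
  by rewrite (poly_loc_cap_finite_type nE); apply: star_tilde_le.
move=> x /(poly_loc_capP _ smE)[l [el lE]]; apply/star_tildeP => // P QP.
have [[iP nP _] _ _] := QP.
apply: contrapT => h; apply: (QMax_one QP).
rewrite -poly_loc_cap_finite_type; last exact: to_K_nz.
apply/poly_loc_capP; first exact: to_K_submod.
exists l; split=> // c cl; exists c; rewrite ?mulr1 //.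
by apply: contrapT => Pc; apply: h; exists c; split=> //; apply: lE.
Qed.

End Localization.

Lemma poly_loc_cap_anti (L M : set (set D)) E : L `<=` M ->
  poly_loc_cap (poly_avoid M) E `<=` poly_loc_cap (poly_avoid L) E.
Proof.
move=> LM x [f [s [fE avs xE]]]; exists f, s; split=> // -[Q LQ sQ].
by apply: avs; exists Q => //; apply: LM.
Qed.

End SemistarTheory.

Section PolynomialRing.
Import GRing.Theory.
Local Open Scope ring_scope.
Local Open Scope classical_set_scope.
Variable D : idomainType.
Local Notation K := {fraction D}.
Local Notation frac := (@tofrac D).
Implicit Types (E F : set K) (I J P : set D) (star : set K -> set K).
Implicit Types (a b c : D) (x y : K).

(** * Primes and denominators in [D[X]] *)

Lemma dvdp_irreducible (F : fieldType) (p : {poly F}) : (1 < size p)%N ->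
  exists2 q, irreducible_poly q & q %| p.
Proof.
have [n] := ubnP (size p); elim: n p => // n IH p le_pn p_gt1.
have [irrp|redp] := pselect (irreducible_poly p); first by exists p.
have [d [d1 dp ndp]] : exists d : {poly F}, [/\ size d != 1%N,
  d %| p & ~~ (d %= p)].
  apply: contrapT => h; apply: redp; split=> // d d1 dp.
  by apply/negPn/negP => ndp; apply: h; exists d.
have p0 : p != 0 by rewrite -size_poly_gt0 (leq_trans _ p_gt1).
have d0 : d != 0 by apply: contra_neq p0 => d0; apply/eqP; rewrite -dvd0p -d0.
have lt_dp : (size d < size p)%N.
  rewrite ltn_neqAle dvdp_leq // andbT; apply: contra ndp => sdp.
  by rewrite -dvdp_size_eqp // sdp.
have [||q irrq qd] := IH d.
- by rewrite (leq_trans lt_dp).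
- by rewrite ltn_neqAle eq_sym d1 size_poly_gt0.
- by exists q => //; apply: dvdp_trans dp.
Qed.

Lemma irreducible_dvdpM (F : fieldType) (p u v : {poly F}) :
  irreducible_poly p -> p %| u * v -> p %| u \/ p %| v.
Proof.
move=> irrp puv; have [|npu] := boolP (p %| u); [by left|right].
suff cpu : coprimep p u by rewrite Gauss_dvdpr in puv.
apply: contraNT npu => ncpu; have := irrp _ ncpu (dvdp_gcdl p u).
by move/eqp_dvdl <-; apply: dvdp_gcdr.
Qed.

Lemma lowest_coef P (p : {poly D}) i : ~ P p`_i ->
  exists j, ~ P p`_j /\ forall k, (k < j)%N -> P p`_k.
Proof.
move=> Pi; have ex : exists j, `[< ~ P p`_j >] by exists i; apply/asboolP.
have [j /asboolP Pj minj] := ex_minnP ex; exists j; split=> // k kj.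
by apply: contrapT => Pk; have := minj k (asboolT Pk); rewrite leqNgt kj.
Qed.

Lemma ideal_sum (R : comNzRingType) (J : set R) (T : Type) (r : seq T)
    (Q : pred T) (F : T -> R) :
  is_ideal J -> (forall i, Q i -> J (F i)) -> J (\sum_(i <- r | Q i) F i).
Proof. by move=> [J0 JD _] h; apply: big_ind. Qed.

Lemma extXP P (p : {poly D}) : P 0 -> extX P p <-> forall i, P p`_i.
Proof. exact: polyOver_setP. Qed.

(** With i and j the lowest indices of coefficients of p and q outside [P], the coefficient of pq of
    index i + j is congruent modulo [P] to the product of these two coefficients. *)
Lemma extX_Spec P : Spec P -> Spec (extX P).
Proof.
move=> sP; have [[P0 PD PM] PT _] := sP; have iP : is_ideal P by split.
have extP p := extXP p P0.
split; first split.
- by apply/extP => i; rewrite coef0.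
- by move=> p q /extP hp /extP hq; apply/extP => i; rewrite coefD; apply: PD.
- move=> p q /extP hq; apply/extP => i; rewrite coefM;
    apply: ideal_sum => // j _.
  exact: PM.
- move=> h; apply: (Spec_one sP); have /extP/(_ 0%N) : extX P 1 by rewrite h.
  by rewrite coef1.
move=> p q /set_mem/extP hpq; apply/orP.
have [hp|hp] := pselect (extX P p); first by left; apply: mem_set.
have [hq|hq] := pselect (extX P q); first by right; apply: mem_set.
have [i' Pi'] : exists i, ~ P p`_i.
  by apply: contrapT => h; apply/hp/extP => i; apply: contrapT => Pi; apply: h;
    exists i.
have [j' Pj'] : exists i, ~ P q`_i.
  by apply: contrapT => h; apply/hq/extP => i; apply: contrapT => Pi; apply: h;
    exists i.
have [i [Pi mini]] := lowest_coef Pi'; have [j [Pj minj]] := lowest_coef Pj'.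
case: (Spec_mulN sP Pi Pj); have := hpq (i + j)%N; rewrite coefM.
have lti : (i < (i + j).+1)%N by rewrite ltnS leq_addr.
rewrite (bigD1 (Ordinal lti)) //= addKn => h.
rewrite -[_ * _](addrK (\sum_(k < (i + j).+1 |
  k != Ordinal lti) p`_k * q`_(i + j - k))).
apply: PD => //; rewrite -mulN1r; apply: (PM); apply: ideal_sum => // k.
rewrite -val_eqE /= neq_ltn => /orP[ki|ik]; first by rewrite mulrC;
  apply/PM/mini.
by apply/PM/minj; rewrite ltn_subLR ?ltn_add2r // -ltnS.
Qed.

(** In the Leibniz expansion, the products for each permutation are compared factor by factor
    through x1 y1 - x2 y2 = x1 (y1 - y2) + y2 (x1 - x2). *)
Lemma det_ideal (R : comNzRingType) (J : set R) n (A B : 'M[R]_n) :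
  is_ideal J -> (forall i k, J (A i k - B i k)) -> J (\det A - \det B).
Proof.
move=> iJ AB; have [J0 JD JM] := iJ.
rewrite /determinant -sumrB; apply: ideal_sum => // s _.
rewrite -mulrBr; apply: (JM).
elim/big_ind2: _ => [|x2 x1 y2 y1 h1 h2|i _] //.
  by rewrite subrr.
have -> : x1 * y1 - x2 * y2 = x1 * (y1 - y2) + y2 * (x1 - x2).
  by rewrite !mulrBr [y2 * x1]mulrC [y2 * x2]mulrC addrA subrK.
by apply: JD; apply: JM.
Qed.

(* Let [j] be the lowest index with [g`_j] outside [P]. The coefficients of
   [f * g] of index at least [j] are the image of those of [f] under a Toeplitz
   matrix which is triangular modulo [P] with diagonal [g`_j], hence whose
   determinant is not in [P]; the adjugate turns this into a common denominator. *)
Lemma coef_denominator P (f : {poly K}) (g h : {poly D}) i : Spec P ->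
  ~ P g`_i ->
  f * map_poly frac g = map_poly frac h ->
  exists d, ~ P d /\ forall k, exists a, frac d * f`_k = frac a.
Proof.
move=> sP Pi fgh; have [iP _ _] := sP; have [P0 PD PM] := iP.
have {i Pi}[j [Pj minj]] := lowest_coef Pi.
pose n := size f.
pose A : 'M[D]_n := \matrix_(i, k) ('X^k * g)`_(i + j).
(* [B] is [A] with the part above the diagonal erased. An erased entry is 0 or a coefficient of [g]
   of index i + j - k < j, so it lies in [P]. *)
pose B : 'M[D]_n := \matrix_(i, k) if (k <= i)%N then A i k else 0.
exists (\det A); split.
  have AB : P (\det B - \det A).
    apply: det_ideal => // i k; rewrite mxE; case: leqP => [_|ik].
      by rewrite subrr.
    rewrite sub0r -mulN1r; apply: (PM); rewrite mxE coefXnM;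
      case: ifP => // ijk.
    by apply: minj; rewrite ltn_subLR ?ltn_add2r // leqNgt ijk.
  move=> PA; have : P (\det B) by rewrite -(subrK (\det A) (\det B)); apply: PD.
  rewrite det_trig; last by apply/is_trig_mxP => i k ik; rewrite mxE leqNgt ik.
  elim/big_ind: _ => [|x y Px Py|i _]; [exact: Spec_one|exact: Spec_mulN|].
  by rewrite mxE leqnn mxE coefXnM ltnNge leq_addr addKn.
move=> k; case: (ltnP k n) => [kn|/(nth_default 0)->]; last first.
  by exists 0; rewrite mulr0 tofrac0.
pose v : 'cV[K]_n := \col_i f`_i.
pose w : 'cV[D]_n := \col_i h`_(i + j).
(* Row i compares the coefficients of index i + j in fg = h. *)
have Avw : map_mx frac A *m v = map_mx frac w.
  apply/matrixP => i z; rewrite !mxE -coef_map -fgh.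
  rewrite -[f in RHS]coefK poly_def mulr_suml coef_sum; apply: eq_bigr => u _.
  rewrite !mxE -scalerAl coefZ mulrC; congr (_ * _).
  by rewrite -coef_map rmorphM /= map_polyXn.
have : map_mx frac (\adj A) *m (map_mx frac A *m v) = frac (\det A) *: v.
  by rewrite mulmxA -map_mxM mul_adj_mx map_scalar_mx mul_scalar_mx.
rewrite Avw -map_mxM => /matrixP/(_ (Ordinal kn) 0); rewrite !mxE /= => <-.
by eexists.
Qed.

(** That x is the polynomial f of K[X] is expressed by a = fb in K[X], as x itself is a fraction
    over D[X]. In lowest terms over K, the denominator [B'] of x divides every g in [l]. Were it not
    constant, an irreducible factor p would give a prime, the trace of pK[X] on D[X], which
    contracts to zero and contains [l]. *)
Lemma fraction_poly (x : {fraction {poly D}}) (l : seq {poly D}) :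
  (forall g, g \in l -> exists h, tofrac g * x = tofrac h) ->
  (forall Q, Spec Q -> contr Q = [set 0] -> exists2 g, g \in l & ~ Q g) ->
  exists (f : {poly K}) (a b : {poly D}),
    [/\ b != 0, x = tofrac a / tofrac b
      & map_poly frac a = f * map_poly frac b].
Proof.
move=> lx lQ; have [a [b [b0 xab]]] := frac_surj x.
have fb0 : tofrac b != 0 by rewrite tofrac_eq0.
pose A := map_poly frac a; pose B := map_poly frac b.
have B0 : B != 0 by rewrite map_frac_eq0.
have G0 : gcdp A B != 0 by rewrite gcdp_eq0 negb_and B0 orbT.
pose A' : {poly K} := A %/ gcdp A B; pose B' : {poly K} := B %/ gcdp A B.
have AE : A = A' * gcdp A B by rewrite divpK ?dvdp_gcdl.
have BE : B = B' * gcdp A B by rewrite divpK ?dvdp_gcdr.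
have cAB : coprimep B' A' by rewrite coprimep_sym coprimep_div_gcd // B0 orbT.
have B'0 : B' != 0 by apply: contra_neq B0 => B'0; rewrite BE B'0 mul0r.
have B's g : g \in l -> B' %| map_poly frac g.
  move=> /lx[h gxh]; rewrite -(Gauss_dvdpl _ cAB).
  have gahb : g * a = h * b.
    by apply/eqP; rewrite -tofrac_eq !tofracM -gxh xab -mulrA divfK.
  suff -> : map_poly frac g * A' = map_poly frac h * B' by apply: dvdp_mull.
  by apply: (mulIf G0); rewrite -!mulrA -AE -BE -!rmorphM gahb.
have [B'1|B'_gt1] : size B' = 1%N \/ (1 < size B')%N.
- by move: B'0; rewrite -size_poly_gt0; case: (size B') => [|[|m]];
    [|left|right].
- have /size_poly1P[c c0 B'c] : size B' == 1%N by apply/eqP.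
  exists (c^-1 *: A'), a, b; split=> //.
  rewrite -/A -/B [in LHS]AE [in RHS]BE B'c mul_polyC -scalerAl -scalerAr scalerA.
  by rewrite mulVf // scale1r.
have [p irrp pB] := dvdp_irreducible B'_gt1.
pose Q : set {poly D} := [set q | p %| map_poly frac q].
have p_gt1 : (1 < size p)%N := irrp.1.
have sQ : Spec Q.
  rewrite /Q; split; first split=> [|u v|u v] /=.
  - by rewrite rmorph0 dvdp0.
  - by rewrite rmorphD; apply: dvdp_add.
  - by rewrite rmorphM; apply: dvdp_mull.
  - move=> /seteqP[_ /(_ 1 Logic.I)] /=; rewrite rmorph1 dvdp1 => /eqP p1.
    by rewrite p1 in p_gt1.
  - move=> u v /set_mem /=; rewrite rmorphM => /(irreducible_dvdpM irrp)[] h.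
      by apply/orP; left; apply: mem_set.
    by apply/orP; right; apply: mem_set.
have [|g gl []] := lQ Q sQ; last exact: dvdp_trans pB (B's _ gl).
apply/seteqP; rewrite /contr; split=> c /=; last by move=> ->;
  rewrite /Q /= !rmorph0 dvdp0.
rewrite /Q /= map_polyC => pc; apply/eqP; rewrite -tofrac_eq0;
  apply: contraTT pc => c0.
by apply: contraL p_gt1 => /dvdp_leq; rewrite polyC_eq0 size_polyC c0 -leqNgt;
  apply.
Qed.

(** * The operation [star[X]] *)

Lemma contr_ideal (Q : set {poly D}) : is_ideal Q -> is_ideal (contr Q).
Proof.
move=> [Q0 QD QM]; rewrite /contr; split=> [|a b Qa Qb|a b Qb] /=.
- by rewrite polyC0.
- by rewrite polyCD; apply: QD.
- by rewrite polyCM; apply: QM.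
Qed.

Lemma Theta_Spec star : Theta star `<=` @Spec {poly D}.
Proof. by move=> Q []. Qed.

Lemma Theta0 star : Theta star [set 0].
Proof.
split; first exact: Spec_set0.
left; apply/seteqP; split=> a; rewrite /contr /=.
  by move/eqP; rewrite polyC_eq0 => /eqP.
by move=> ->.
Qed.

(** [Theta] sees an operation only through whether 1 lies in the [star_f] closure of a nonzero
    contraction. *)
Lemma eq_Theta star1 star2 : semistar star1 -> semistar star2 ->
  (forall I, is_ideal I -> I <> [set 0] ->
    star_f star1 (to_K I) 1 <-> star_f star2 (to_K I) 1) ->
  Theta star1 = Theta star2.
Proof.
move=> s1 s2 s12; apply/seteqP; split=> Q [sQ Qp]; split=> //;
  have [/contr_ideal iC _ _] := sQ;
  have [C0|nC] := pselect (contr Q = [set 0]); first [by left|right];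
  case: Qp => // /(star_f_proper _ iC nC) Q1;
  apply/(star_f_proper _ iC nC) => // h; apply: Q1 => //; exact/(s12 _ iC nC).
Qed.

Lemma star_X_tilde star : semistar star ->
  star_X (star_tilde star) = star_X star.
Proof.
move=> star_semi; rewrite /star_X (@eq_Theta _ star) //.
  exact: star_tilde_semistar.
by move=> I iI nI; apply: star_f_tilde_one.
Qed.

Lemma star_X_star_f star : semistar star -> star_X (star_f star) = star_X star.
Proof.
move=> star_semi; rewrite /star_X (@eq_Theta _ star) //.
  exact: star_f_semistar.
move=> I iI nI; have smI := to_K_submod iI.
split=> /(star_fP _ _ smI)[s [sI ns s1]]; apply/star_fP => //; exists s;
  split=> //.
  by rewrite -(star_f_span star_semi ns).
by rewrite star_f_span.
Qed.

Lemma Theta_id : Theta (@star_id D) = @Spec {poly D}.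
Proof.
apply/seteqP; split=> [|Q sQ]; first exact: Theta_Spec.
split=> //; have [/contr_ideal iC _ _] := sQ.
have [C0|nC] := pselect (contr Q = [set 0]); [by left|right].
apply/(star_f_proper (star_id_semistar D) iC nC) =>
  /(star_f_id (to_K_submod iC)).
by rewrite -tofrac1 => /to_KE; rewrite /contr /= polyC1; apply: Spec_one.
Qed.

(** If x is not in [E], the ideal (E : x) of D[X] omits 1 and lies in a prime, obtained from
    [exists_QMax] for the identity on D[X]. As [Theta] is here the whole spectrum, a list inside (E
    : x) cannot escape that prime. *)
Lemma star_X_id : star_eq (star_X (@star_id D)) (@star_id {poly D}).
Proof.
have idS := star_id_semistar {poly D}.
have T0 := Theta0 (@star_id D); have TS := @Theta_Spec (@star_id D).
move=> E nE; have [smE _] := nE; apply/seteqP; split;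
  last exact: poly_loc_cap_ext.
move=> x /(poly_loc_capP TS T0 _ smE)[l [el lE]].
have iI := colon_ideal x smE; have nI := @colon_nz _ E x nE.
apply: contrapT => Ex.
have [|P QP IP] := exists_QMax idS iI nI.
  move=> /(star_f_id (to_K_submod iI)); rewrite -tofrac1 => /to_KE.
  by rewrite /colon /= tofrac1 mul1r.
have sP := QMax_Spec (star_f_semistar idS) QP.
have [|c cl Pc] := el P; first by rewrite Theta_id.
by apply/Pc/IP/lE.
Qed.

Lemma extX_Theta star P : semistar star -> QMax (star_f star) P ->
  Theta star (extX P).
Proof.
move=> star_semi QP; have sP := QMax_Spec (star_f_semistar star_semi) QP.
have [[iP nP _] _ _] := QP; have P0 : P 0 by case: iP.
split; [exact: extX_Spec|right].
have cP : contr (extX P) = P.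
  apply/seteqP; split=> a; rewrite /contr /=.
    by move/(extXP _ P0)/(_ 0%N); rewrite coefC.
  by move=> Pa; apply/(extXP _ P0) => i; rewrite coefC; case: ifP.
rewrite /contr_proper cP; apply/star_f_proper => //; exact: QMax_one QP.
Qed.

Lemma star_X_polynomials star : semi_star star ->
  star_X star (to_K setT) = to_K setT.
Proof.
move=> [star_semi starD]; set DX : set {fraction {poly D}} := to_K setT.
have nDX : nz_submod DX := to_KT_nz _.
have smDX : is_submod DX by case: nDX.
have T0 := Theta0 star; have TS := @Theta_Spec star.
apply/seteqP; split; last exact: poly_loc_cap_ext.
move=> x /(poly_loc_capP TS T0 _ smDX)[l [el lDX]].
have [||f [a [b [b0 xab fab]]]] := @fraction_poly x l.
- by move=> g /lDX[h _ <-]; exists h.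
- by move=> Q sQ Q0; apply: el; split=> //; left.
(* The relations gx = h hold in the quotient field of D[X]; cancelling the image of [b] carries them
   over to K[X], with [f] in place of [x]. *)
have lf g : g \in l -> exists h, f * map_poly frac g = map_poly frac h.
  move=> /lDX[h _ hgx]; exists h.
  have b'0 : map_poly frac b != 0 by rewrite map_frac_eq0.
  apply: (mulIf b'0); rewrite mulrAC -fab -!rmorphM; congr map_poly.
  apply/eqP; rewrite -tofrac_eq !tofracM hgx xab.
  by rewrite -[X in _ == X]mulrA divfK ?tofrac_eq0 // mulrC.
have fD k : exists c, f`_k = frac c.
  suff [c _ <-] : to_K setT f`_k by exists c.
  have <- : star_f star (to_K setT) = to_K setT.
    have nD := to_KT_nz D; rewrite -[RHS]starD to_KT_span in nD *.
    exact: star_f_span.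
  have smD : is_submod (to_K [set: D]) by apply: to_K_submod.
  (* It remains to test each coefficient at every P of [QMax], where [coef_denominator] gives a
     denominator outside P. *)
  apply: (star_tilde_le star_semi (to_KT_nz D)).
  apply/star_tildeP => // P QP.
  have sP := QMax_Spec (star_f_semistar star_semi) QP.
  have P0 : P 0 by case: sP => -[].
  have [g gl Pg] := el _ (extX_Theta star_semi QP).
  have [i Pi] : exists i, ~ P g`_i.
    apply: contrapT => h; apply/Pg/(extXP _ P0) => i.
    by apply: contrapT => Pi; apply: h; exists i.
  have [h fgh] := lf _ gl; have [d [Pd df]] := coef_denominator sP Pi fgh.
  by have [e de] := df k; exists d; split=> //; exists e.
have [F fF] := choice fD.
pose f0 := \poly_(k < size f) F k.
have ff0 : f = map_poly frac f0.
  apply/polyP => k; rewrite coef_map coef_poly; case: ltnP => [_|kf];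
    first exact: fF.
  by rewrite nth_default // raddf0.
exists f0 => //; rewrite xab; suff -> : a = f0 * b.
  by rewrite tofracM mulfK // tofrac_eq0.
by apply: (@map_frac_inj D); rewrite fab ff0 rmorphM.
Qed.

End PolynomialRing.

Theorem theorem2p1 (D : idomainType)
    (star : set {fraction D} -> set {fraction D}) (star_semi : semistar star) :
  [/\ (* (a) *)
      [/\ semistar (star_X star), stable (star_X star),
          finite_type (star_X star)
        & star_eq (star_tilde (star_X star)) (star_X star)],
      (* (b) *)
      star_eq (star_X (star_tilde star)) (star_X (star_f star)) /\
      star_eq (star_X (star_f star)) (star_X star),
      (* (c) *)
      star_le (star_X star) (star_bracket star) /\
      (semi_star star -> semi_star (star_X star))
    & (* (d) *)
      star_eq (star_X (@star_id D)) (@star_id {poly D})].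
Proof.
have T0 := Theta0 star; have TS := @Theta_Spec D star.
have starX_semi : semistar (star_X star) by apply: poly_loc_cap_semistar.
split.
- split=> //; [exact: poly_loc_cap_stable|exact: poly_loc_cap_finite_type|].
  exact: poly_loc_cap_tilde.
- by split=> E _; rewrite ?star_X_tilde ?star_X_star_f.
- split=> [E _|star_semiD]; last by split=> //; apply: star_X_polynomials.
  (* [Delta] is contained in [Theta], so avoiding its primes inverts at least as many
     polynomials. *)
  apply: poly_loc_cap_anti => Q [sQ [Q0|[_ Qp]]]; split=> //;
    [by left|by right].
- exact: star_X_id.
Qed.
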